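(* Let $\mathbb{X}$ and $\mathbb{Y}$ be Hausdorff topological spaces, let $\Phi:\mathbb{X}\to 2^{\mathbb{Y}}\setminus\{\emptyset\}$ be a set-valued mapping, let $u:\mathrm{Gr}_{\mathbb{X}}(\Phi)\subseteq\mathbb{X}\times\mathbb{Y}\to\overline{\mathbb{R}}$, and let $x\in\mathbb{X}$. If $u$ is $\mathbb{K}\mathbb{N}$-inf-compact on $\mathrm{Gr}_{\{x\}}(\Phi)$, the value function $v:\mathbb{X}\to\overline{\mathbb{R}}$ is continuous at $x$, and $v(x)<+\infty$, then $\Phi^*(x)$ is a nonempty compact subset of $\mathbb{Y}$ and the solution multifunction $\Phi^*$ is upper semi-continuous at $x$.
   Context: $\overline{\mathbb{R}}=\mathbb{R}\cup\{\pm\infty\}$. For $Z\subseteq\mathbb{X}$, $\mathrm{Gr}_Z(\Phi)=\{(x,y)\in Z\times\mathbb{Y}: y\in\Phi(x)\}$. The value function is $v(z):=\inf_{y\in\Phi(z)}u(z,y)$, $z\in\mathbb{X}$, and the solution multifunction $\Phi^*:\mathbb{X}\to 2^{\mathbb{Y}}$ is $\Phi^*(z):=\{y\in\Phi(z): v(z)=u(z,y)\}$, $z\in\mathbb{X}$ (possibly empty for some $z$). For a nonempty subset $A$ of a Hausdorff topological space $\mathbb{A}$, a function $f:A\subseteq\mathbb{A}\to\overline{\mathbb{R}}$ is lower semi-continuous at $a\in A$ if $\liminf_i f(a_i)\ge f(a)$ for each net $\{a_i\}_{i\in I}\subset A$ converging to $a$ in $\mathbb{A}$; it is upper semi-continuous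 at $a$ if $-f$ is lower semi-continuous at $a$; it is continuous at $a$ if it is both lower and upper semi-continuous at $a$. For a nonempty set $Z\subseteq\mathbb{X}$, a function $u:\mathrm{Gr}_{\mathbb{X}}(\Phi)\subseteq\mathbb{X}\times\mathbb{Y}\to\overline{\mathbb{R}}$ is called $\mathbb{K}\mathbb{N}$-inf-compact on $\mathrm{Gr}_Z(\Phi)$ if: (i) $u:\mathrm{Gr}_{\mathbb{X}}(\Phi)\subseteq\mathbb{X}\times\mathbb{Y}\to\overline{\mathbb{R}}$ is lower semi-continuous at all $(x,y)\in\mathrm{Gr}_Z(\Phi)$; (ii) if a net $\{x_i\}_{i\in I}$ with values in $\mathbb{X}$ converges to $x\in Z$, then each net $\{y_i\}_{i\in I}$, defined on the same index set $I$, with $y_i\in\Phi(x_i)$ for all $i\in I$ and such that the set $\{u(x_i,y_i): i\in I\}$ is bounded above (by a real number), has an accumulation point $y\in\Phi(x)$. A set-valued mapping $F:\mathbb{X}\to 2^{\mathbb{Y}}$ is upper semi-continuous at a point $x$ with $F(x)\neq\emptyset$ if for each neighborhood $\mathcal{G}$ of the set $F(x)$ there is a neighborhood $\mathcal{O}(x)$ of $x$ such that $F(x^* )\subseteq\mathcal{G}$ for all $x^*\in\mathcal{O}(x)$. *)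

(* Defs.v *)
From HB Require Import structures.
From mathcomp Require Import all_boot all_order all_algebra.
From mathcomp Require Import all_classical all_reals all_analysis.

Set Implicit Arguments.
Unset Strict Implicit.
Unset Printing Implicit Defensive.

Local Open Scope classical_set_scope.
Local Open Scope ereal_scope.

(* An extended-real function f : A `<=` T -> \bar R is encoded by a total
   function on T together with its domain A; every definition below only looks
   at the values of f on A. *)

Definition directed (I : Type) (le : I -> I -> Prop) : Prop :=
  [/\ inhabited I,
      forall i, le i i,
      forall i j k, le i j -> le j k -> le i k &
      forall i j, exists k, le i k /\ le j k].

(* The eventuality filter of a net, pulled back to the index set: it is
   generated by the tails {j | i <= j}. *)
Definition tails (I : Type) (le : I -> I -> Prop) : set_system I :=
  filter_from [set: I] (fun i => [set j | le i j]).

Definition net_cvg (I : Type) (le : I -> I -> Prop) (T : topologicalType)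
    (a : I -> T) (l : T) : Prop :=
  fmap a (tails le) `=>` nbhs l.

(* l is an accumulation point of the net a: a is frequently in each
   neighborhood of l. *)
Definition net_accumulation (I : Type) (le : I -> I -> Prop)
    (T : topologicalType) (a : I -> T) (l : T) : Prop :=
  cluster (fmap a (tails le)) l.

Definition net_liminf (R : realType) (I : Type) (le : I -> I -> Prop)
    (c : I -> \bar R) : \bar R :=
  ereal_sup [set ereal_inf [set c j | j in [set j | le i j]] | i in [set: I]].

Definition lsc_at (R : realType) (T : topologicalType) (A : set T)
    (f : T -> \bar R) (a : T) : Prop :=
  forall (I : Type) (le : I -> I -> Prop) (s : I -> T),
    directed le -> (forall i, A (s i)) -> net_cvg le s a ->
    f a <= net_liminf le (fun i => f (s i)).

Definition usc_at (R : realType) (T : topologicalType) (A : set T)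
    (f : T -> \bar R) (a : T) : Prop :=
  lsc_at A (fun t => - f t) a.

Definition continuous_at_by_nets (R : realType) (T : topologicalType) (A : set T)
    (f : T -> \bar R) (a : T) : Prop :=
  lsc_at A f a /\ usc_at A f a.

Definition Gr (X Y : Type) (Z : set X) (Phi : X -> set Y) : set (X * Y) :=
  [set p | Z p.1 /\ Phi p.1 p.2].

Definition KN_inf_compact (R : realType) (X Y : topologicalType)
    (Phi : X -> set Y) (u : X * Y -> \bar R) (Z : set X) : Prop :=
  (forall p, Gr Z Phi p -> lsc_at (Gr [set: X] Phi) u p) /\
  (forall (I : Type) (le : I -> I -> Prop) (xs : I -> X) (x : X),
     directed le -> Z x -> net_cvg le xs x ->
     forall ys : I -> Y,
       (forall i, Phi (xs i) (ys i)) ->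
       (exists M : R, forall i, u (xs i, ys i) <= M%:E) ->
       exists2 y, Phi x y & net_accumulation le ys y).

Definition value (R : realType) (X Y : Type) (Phi : X -> set Y)
    (u : X * Y -> \bar R) (z : X) : \bar R :=
  ereal_inf [set u (z, y) | y in Phi z].

Definition solution (R : realType) (X Y : Type) (Phi : X -> set Y)
    (u : X * Y -> \bar R) (z : X) : set Y :=
  [set y | Phi z y /\ value Phi u z = u (z, y)].

Definition set_valued_usc_at (X Y : topologicalType) (F : X -> set Y) (x : X) :
    Prop :=
  F x !=set0 /\
  forall G : set Y, set_nbhs (F x) G ->
    exists2 O : set X, nbhs x O & forall x', O x' -> F x' `<=` G.

(* Main.v *)
Require Import Defs.
From mathcomp Require Import all_boot all_order all_algebra.
From mathcomp Require Import all_classical all_reals all_analysis.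

Import Order.TTheory GRing.Theory Num.Theory.

Local Open Scope classical_set_scope.
Local Open Scope ereal_scope.

(** Every proper filter is the eventuality filter of a net, so the hypotheses on
    nets apply to filters.  The key fact is that a proper filter on the graph of
    [Phi] whose first projection tends to [x] and along which
    [limsup u <= v(x)] has, in second projection, a cluster point in
    [Phi^*(x)]: inf-compactness gives a cluster point [y] in [Phi(x)], and lower
    semi-continuity along a finer filter tending to [(x, y)] gives
    [u(x, y) <= v(x)].  Nonemptiness applies it to the sublevel sets of
    [u(x, _)] above [v(x)], compactness to filters on [Phi^*(x)].  For upper
    semi-continuity, if [Phi^*] left a neighborhood [C] of [Phi^*(x)] at points
    arbitrarily close to [x], the points of its graph outside [C] would cluster
    at a point of [Phi^*(x)], because [u = v] on that graph and [v] is upper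
    semi-continuous at [x]. *)

Lemma ereal_lt_dense (R : realType) (a b : \bar R) :
  a < b -> exists2 r : R, a < r%:E & r%:E < b.
Proof.
case: a b => [a||] [b||] // ab.
- by have [??] := midf_lt ab; exists ((a + b) / 2)%R; rewrite lte_fin.
- by exists (a + 1)%R; rewrite ?ltry // lte_fin ltrDl.
- by exists (b - 1)%R; rewrite ?ltNyr // lte_fin gtrDl ltrN10.
- by exists 0%R; rewrite ?ltNyr ?ltry.
Qed.

(** An index is a set of [F] with a chosen point of it lying in [D]; indices are ordered by reverse
    inclusion of the sets, and the net returns the point. *)
Lemma filter_eq_tails_net (T : Type) (F : set_system T) (D : set T) :
  ProperFilter F -> F D ->
  exists (I : Type) (le : I -> I -> Prop) (s : I -> T),
    [/\ directed le, forall i, D (s i) & fmap s (tails le) = F].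
Proof.
move=> FF FD.
pose I := {q : T * set T | [/\ F q.2, q.2 q.1 & D q.1]}.
pose le (i j : I) := (sval j).2 `<=` (sval i).2.
have mk A : F A -> exists i : I, (sval i).2 = A.
  move=> FA; have [p [Ap Dp]] := filter_ex (filterI FA FD).
  by exists (exist _ (p, A) (And3 FA Ap Dp)).
exists I, le, (fun i => (sval i).1); split.
- split.
  + by have [i _] := mk _ FD; exists.
  + by move=> i; apply: subset_refl.
  + by move=> i j k ij jk; apply: subset_trans jk ij.
  + move=> i j; have [Fi _ _] := svalP i; have [Fj _ _] := svalP j.
    have [k kE] := mk _ (filterI Fi Fj).
    by exists k; rewrite /le kE; split; [apply: subIsetl|apply: subIsetr].
- by move=> i; case: (svalP i).
(* The tail at an index with set [B] has image exactly [B] intersected with [D]. *)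
- apply/seteqP; split=> A.
  + move=> [i _ iA]; have [Fi _ _] := svalP i.
    apply: filterS (filterI Fi FD) => p [ip Dp].
    exact: (iA (exist _ (p, (sval i).2) (And3 Fi ip Dp))).
  + move=> /mk[i iE]; exists i => // j ij.
    by rewrite -iE; apply: ij; case: (svalP j).
Qed.

Lemma lsc_at_filter (R : realType) (T : topologicalType) (A : set T)
    (f : T -> \bar R) (a : T) (F : set_system T) (c : \bar R) :
  lsc_at A f a -> ProperFilter F -> F A -> F `=>` nbhs a ->
  F [set t | f t <= c] -> f a <= c.
Proof.
move=> fa FF FA Fa Fc.
have [I [le [s [dle sP sF]]]] := filter_eq_tails_net _ _ _ FF (filterI FA Fc).
apply: (le_trans (fa I le s dle _ _)) => [i||].
- by case: (sP i).
- by rewrite /net_cvg sF.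
(* Each tail contains its own first index, where [f <= c], so every tail infimum is at most [c]. *)
- apply: ge_ereal_sup => _ [i _ <-].
  apply: ge_ereal_inf; exists (f (s i)); first by exists i => //=; case: dle.
  by case: (sP i).
Qed.

(** Otherwise the trace of [nbhs a] on the set where [c <= f] is a proper filter, and upper
    semi-continuity along it yields [c <= f a]. *)
Lemma usc_at_near (R : realType) (T : topologicalType) (f : T -> \bar R)
    (a : T) (c : \bar R) :
  usc_at [set: T] f a -> f a < c -> nbhs a [set t | f t < c].
Proof.
move=> fa fac; apply: contrapT => nfc.
have PF : ProperFilter (within [set t | c <= f t] (nbhs a)).
  apply: Build_ProperFilter_ex => B; rewrite /within.
  move=> aB; apply: contrapT => /forallNP B0; apply: nfc.
  have {}aB : nbhs a (fun t => c <= f t -> B t) := aB.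
  apply: filterS aB => t tB /=; rewrite ltNge; apply/negP => /tB.
  exact: B0.
have : - f a <= - c.
  apply: (lsc_at_filter _ _ _ _ _ _ _ fa PF).
  - exact: filterT.
  - exact: cvg_within.
  - by apply: (filterS _ (withinT _ _)) => t; rewrite /= leeN2.
by rewrite leeN2 leNgt fac.
Qed.

Section KN_inf_compact_at.
Context (R : realType) (X Y : topologicalType) (Phi : X -> set Y).
Context (u : X * Y -> \bar R) (x : X).
Hypothesis hu : KN_inf_compact Phi u [set x].

Lemma KN_inf_compact_filter (F : set_system (X * Y)) (M : R) :
  ProperFilter F -> F (Gr [set: X] Phi) -> fst @ F `=>` nbhs x ->
  F [set p | u p <= M%:E] -> exists2 y, Phi x y & cluster (snd @ F) y.
Proof.
move=> FF FG Fx FM.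
have [I [le [s [dle sP sF]]]] := filter_eq_tails_net _ _ _ FF (filterI FG FM).
have [||i||y xy yc] := hu.2 I le (fst \o s) x dle _ _ (snd \o s).
- by [].
- by move=> A /Fx; rewrite -sF.
- by case: (sP i) => -[].
- by exists M => i /=; rewrite -surjective_pairing; case: (sP i).
- by exists y => //; rewrite -sF.
Qed.

Lemma cluster_solution (F : set_system (X * Y)) :
  value Phi u x < +oo -> ProperFilter F -> F (Gr [set: X] Phi) ->
  fst @ F `=>` nbhs x ->
  (forall c, value Phi u x < c -> F [set p | u p <= c]) ->
  solution Phi u x `&` cluster (snd @ F) !=set0.
Proof.
move=> vx FF FG Fx Fu.
(* Inf-compactness asks for a real bound, while [value Phi u x] may be [-oo]. *)
have [M vM _] := ereal_lt_dense _ _ _ vx.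
have [y xy yc] := KN_inf_compact_filter F M FF FG Fx (Fu _ vM).
exists y; split=> //; split=> //; apply/eqP; rewrite eq_le; apply/andP; split.
  by apply: ereal_inf_lbound; exists y.
(* [G] refines [F] by the cylinders over neighborhoods of [y]: it is proper because [y] is a cluster
   point, and it tends to [(x, y)]. *)
pose G := filter_from [set AB : set (X * Y) * set Y | F AB.1 /\ nbhs y AB.2]
  (fun AB => AB.1 `&` snd @^-1` AB.2).
have PG : ProperFilter G.
  apply: filter_from_proper.
    apply: filter_from_filter.
      by exists (setT, setT); split; apply: filterT.
    move=> [A B] [A' B'] [/= FA yB] [/= FA' yB'].
    exists (A `&` A', B `&` B'); first by split; apply: filterI.
    by move=> p [[Ap A'p] [Bp B'p]].
  move=> [A B] [/= FA yB].
  have [|_ [[p Ap <-] Bp]] := yc (snd @` A) B _ yB; last by exists p.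
  by apply: (filterS (_ : A `<=` _) FA) => p Ap; exists p.
have FG' A : F A -> G A.
  by move=> FA; exists (A, setT) => [|p []//]; split=> //; apply: filterT.
(* A real [r] strictly between [value Phi u x] and [u (x, y)] is contradicted by lower
   semi-continuity along [G], which contains the set where [u <= r]. *)
rewrite leNgt; apply/negP => /ereal_lt_dense[r vr]; apply/negP; rewrite -leNgt.
apply: (lsc_at_filter _ _ _ _ _ _ _ (hu.1 (x, y) _) PG).
- by [].
- exact: FG'.
- move=> A [[B C] [/= xB yC] BCA].
  exists (fst @^-1` B, C); first by split=> //; apply: Fx.
  by move=> p [Bp Cp]; apply: BCA.
- by apply: FG'; apply: Fu.
Qed.

Lemma solution_nonempty :
  value Phi u x < +oo -> solution Phi u x !=set0.
Proof.
move=> vx.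
pose F := filter_from [set c | value Phi u x < c]
  (fun c => [set p : X * Y | [/\ p.1 = x, Phi x p.2 & u p <= c]]).
have PF : ProperFilter F.
  apply: filter_from_proper.
    (* The level [+oo] is admissible because [value Phi u x < +oo]. *)
    apply: filter_from_filter; first by exists +oo.
    move=> c d vc vd; exists (Order.min c d); first by rewrite /= lt_min vc vd.
    by move=> p [px pP]; rewrite le_min => /andP[pc pd].
  move=> c /ereal_inf_lt[_ [y xy <-] uc].
  by exists (x, y); split=> //; apply: ltW.
have [|||y []] := cluster_solution F vx PF.
- by exists +oo => // p [px pP _]; split=> //; rewrite px.
- by move=> A /nbhs_singleton Ax; exists +oo => // p [px _ _]; rewrite /= px.
- by move=> c vc; exists c => // p [].
- by exists y.
Qed.

Lemma solution_compact :
  value Phi u x < +oo -> compact (solution Phi u x).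
Proof.
move=> vx F FF Fsol.
have [|||y [yS yF]] := cluster_solution ((fun y => (x, y)) @ F) vx (fmap_proper_filter _ _).
- by apply: (filterS (_ : solution Phi u x `<=` _) Fsol) => y [].
- by move=> A /nbhs_singleton Ax; apply: (@filterE _ F).
- by move=> c vc; apply: (filterS (_ : solution Phi u x `<=` _) Fsol) => y [_ /= <-]; apply: ltW.
- by exists y.
Qed.

Lemma solution_usc :
  value Phi u x < +oo -> usc_at [set: X] (value Phi u) x ->
  set_valued_usc_at (solution Phi u) x.
Proof.
move=> vx vusc; split; first exact: solution_nonempty.
move=> C solC; apply: contrapT => nC.
pose F := filter_from (nbhs x)
  (fun O => [set p : X * Y | [/\ O p.1, solution Phi u p.1 p.2 & ~ C p.2]]).
have PF : ProperFilter F.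
  apply: filter_from_proper.
    apply: filter_from_filter; first by exists setT; apply: filterT.
    move=> A B xA xB; exists (A `&` B); first exact: filterI.
    by move=> p [[Ap Bp] ps pC].
  move=> O xO; apply: contrapT => /forallNP O0; apply: nC; exists O => //.
  move=> z Oz y zy; apply: contrapT => nCy; exact: (O0 (z, y)).
have [|||y [yS yF]] := cluster_solution F vx PF.
- by exists setT; [exact: filterT|move=> p [_ []]].
- by move=> A xA; exists A => // p [].
- move=> c vc; exists [set z | value Phi u z < c]; first exact: usc_at_near.
  by move=> [z y] [/= zc [_ /= <-] _]; apply: ltW.
(* [C] is a neighborhood of [y], yet the second projection of [F] contains its complement, so [y]
   cannot be a cluster point. *)
- have [|z []//] := yF (~` C) C _ (solC y yS).
  by exists setT; [exact: filterT|move=> p []].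
Qed.

End KN_inf_compact_at.

Theorem theorem5 (R : realType) (X Y : topologicalType)
    (hX : hausdorff_space X) (hY : hausdorff_space Y)
    (Phi : X -> set Y) (hPhi : forall z, Phi z !=set0)
    (u : X * Y -> \bar R) (x : X)
    (hu : KN_inf_compact Phi u [set x])
    (hv : continuous_at_by_nets [set: X] (value Phi u) x)
    (hvx : value Phi u x < +oo) :
  [/\ solution Phi u x !=set0,
      compact (solution Phi u x) &
      set_valued_usc_at (solution Phi u) x].
Proof.
split.
- exact: solution_nonempty.
- exact: solution_compact.
- exact: solution_usc hvx hv.2.
Qed.
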